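(* Let $(G,H)$ be a reduced Hecke pair with Schlichting completion $(\overline G,\overline H)$, and let $p=\chi_{\overline H}\in C_c(\overline G)$. For all $x\in\overline G$, $$pxp=\frac{1}{L(x)}\sum_{h\overline H_x\in\overline H/\overline H_x}hxp=\frac{1}{L(x)}\chi_{\overline Hx\overline H},$$ where $\overline H_x=\overline H\cap x\overline Hx^{-1}$ and $L(x)=[\overline H:\overline H_x]$. The $*$-algebras $pC_c(\overline G)p$ and $\mathcal{H}(\overline G,\overline H)$ are identical, and the restriction to this algebra of the $L^1$-norm on $C_c(\overline G)$ coincides with the $\ell^1$-norm $\|f\|_1=\sum_{y\overline H\in\overline G/\overline H}|f(y)|$ on the Hecke algebra. In particular, $\|pxp\|_1=1$ for each $x\in\overline G$.
   Context: $(G,H)$ ($H$ a subgroup of a group $G$) is a Hecke pair if every double coset $HxH$ is a finite union of left cosets of $H$; it is reduced if $\bigcap_{x\in G}xHx^{-1}=\{e\}$. For a Hecke pair $(G,H)$ put $L(x)=|HxH/H|=[H:H\cap xHx^{-1}]$ and $\Delta(x)=L(x)/L(x^{-1})$. The Hecke algebra $\mathcal{H}(G,H)$ is the $*$-algebra $\mathrm{span}\{\chi_{HxH}:x\in G\}$ of functions on $G$ with operations $$f*g(x)=\sum_{yH\in G/H}f(y)g(y^{-1}x),\qquad f^*(x)=\overline{f(x^{-1})}\Delta(x^{-1}).$$ Let $\mathrm{Map}(G/H)$ be the set of all maps $G/H\to G/H$ with the topology of pointwise convergence ($G/H$ discrete), and let $\theta(x)(yH)=xyH$. The Schlichting completion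 is $\overline G=\overline{\theta(G)}$, $\overline H=\overline{\theta(H)}$ (closures in $\mathrm{Map}(G/H)$); $\overline G$ is a locally compact group of permutations of $G/H$, $\overline H$ is a compact open subgroup, and $G$ is identified with the dense subgroup $\theta(G)$. Left Haar measure on $\overline G$ is normalized so that $\overline H$ has measure $1$. $C_c(\overline G)$ is the convolution $*$-algebra with $f*g(x)=\int_{\overline G}f(t)g(t^{-1}x)\,dt$ and $f^*(x)=\overline{f(x^{-1})}\Delta_{\overline G}(x^{-1})$, where $\Delta_{\overline G}$ is the modular function of $\overline G$ (which coincides with the function $\Delta$ of the Hecke pair $(\overline G,\overline H)$). For $x\in\overline G$ and $f\in C_c(\overline G)$, $(xf)(s)=f(x^{-1}s)$ and $(fx)(s)=f(sx^{-1})\Delta_{\overline G}(x^{-1})$. With these conventions $p$ is a projection ($p=p^*=p*p$), and $pxp=p*(xp)=(px)*p$. *)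

(* Defs.v *)
From HB Require Import structures.
From mathcomp Require Import all_boot all_order all_algebra.
From mathcomp Require Import all_classical all_reals all_analysis.
From mathcomp Require Import finmap complex.

Set Implicit Arguments.
Unset Strict Implicit.
Unset Printing Implicit Defensive.

Import Order.TTheory GRing.Theory Num.Theory.
Import numFieldNormedType.Exports.

Local Open Scope classical_set_scope.
Local Open Scope ring_scope.

Section Cosets.
Context {G : groupType}.
Implicit Types (H A : set G) (x : G).

Definition lcoset x A : set G := [set (x * h)%g | h in A].

Definition lcosets A H : set (set G) := [set lcoset x H | x in A].

Definition dcoset H x : set G := [set (h * x * k)%g | h in H & k in H].

Definition conjg_set x H : set G := [set (x * h * x^-1)%g | h in H].

Definition hecke_pair H : Prop :=
  group_closed (mem H) /\
  forall x, exists2 F : set G, finite_set F &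
    dcoset H x = \bigcup_(y in F) lcoset y H.

Definition reduced H : Prop := \bigcap_(x in setT) conjg_set x H = [set 1%g].

(* |HxH/H|; as [fset_set] sends infinite sets to fset0, [hecke_L] and
   [subgroup_index] are 0 instead of infinite. *)
Definition hecke_L H x : nat := #|` fset_set (lcosets (dcoset H x) H)|%fset.

(* [H : K] *)
Definition subgroup_index H K : nat := #|` fset_set (lcosets H K)|%fset.
End Cosets.

HB.mixin Record isTopologicalGroup T of Group T & PointedTopological T := {
  mulg_continuous : continuous (fun xy : T * T => (xy.1 * xy.2)%g);
  invg_continuous : continuous (fun x : T => x^-1%g)
}.

#[short(type="topGroupType")]
HB.structure Definition TopologicalGroup :=
  { T of Group T & PointedTopological T & isTopologicalGroup T }.

Section Schlichting.
Context {G : groupType} (H : set G).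

Definition coset_space : Type := set_type (lcosets (setT : set G) H).
HB.instance Definition _ := Choice.on coset_space.

(* Map(G/H) with the topology of pointwise convergence *)
Definition coset_map : Type :=
  {ptws coset_space -> discrete_topology coset_space}.
HB.instance Definition _ := Topological.on coset_map.

Lemma lcosetM x y : [set (x * h)%g | h in lcoset y H] = lcoset (x * y)%g H.
Proof.
by rewrite /lcoset image_comp; apply: eq_imagel => h _ /=; rewrite mulgA.
Qed.

Lemma theta_subproof x (A : coset_space) :
  [set (x * h)%g | h in val A] \in lcosets (setT : set G) H.
Proof.
have [y _ <-] := set_valP A.
by rewrite lcosetM; apply/mem_set; exists (x * y)%g.
Qed.

Definition theta x : coset_map :=
  fun A => exist (fun B => B \in lcosets setT H) _ (theta_subproof x A).

Definition coset1_subproof : lcoset 1%g H \in lcosets (setT : set G) H :=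
  mem_set (ex_intro2 _ _ 1%g I erefl).
Definition coset1 : coset_space :=
  exist (fun B => B \in lcosets setT H) _ coset1_subproof.

Lemma theta1 : theta 1%g = id.
Proof.
apply/funext => A; apply: val_inj => /=.
by rewrite (eq_imagel (fun _ _ => mul1g _)) image_id.
Qed.

Lemma thetaM x y : theta (x * y)%g = theta x \o theta y.
Proof.
apply/funext => A; apply: val_inj => /=.
by rewrite image_comp; apply: eq_imagel => h _ /=; rewrite mulgA.
Qed.

Lemma thetaK x : cancel (theta x) (theta x^-1%g).
Proof.
by move=> A; rewrite -[LHS]/((theta _ \o theta _) A) -thetaM mulVg theta1.
Qed.

Lemma theta_inj x : injective (theta x).
Proof. exact: can_inj (thetaK x). Qed.

Lemma coset_map_cvgP (F : set_system coset_map) (f : coset_map) : Filter F ->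
  (F --> f) <-> (forall A, F [set g | g A = f A]).
Proof.
move=> FF; split=> [Ff A|Ff].
  apply: Ff.
  have /= := @proj_continuous _ (fun=> discrete_topology coset_space) A f.
  by move=> /(_ [set f A] (discrete_set1 _)).
apply/cvg_sup => A U [V] [[W oW] <- WfA WU].
by apply: filterS (Ff A) => g gA; apply: WU => /=; rewrite /= gA.
Qed.

Lemma nbhs_coset_map (f : coset_map) A : nbhs f [set g : coset_map | g A = f A].
Proof. exact: (coset_map_cvgP f (nbhs_filter f)).1. Qed.

Definition Gbar_set : set coset_map := closure (range theta).

Lemma Gbar_setP (f : coset_map) : Gbar_set f <->
  (forall s : seq coset_space, exists x, forall A, A \in s -> f A = theta x A).
Proof.
split=> [fG s|fG B Bf].
  suff /fG[_ [[x _ <-]] /= xs] :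
    nbhs f [set g : coset_map | forall A, A \in s -> g A = f A].
    by exists x => A /xs.
  elim: s => [|A s IHs]; first by apply: filterS filterT => g _ A.
  apply: filterS2 (nbhs_coset_map f A) IHs => g gA gs B.
  by rewrite inE => /predU1P[->|/gs].
suff [s sB] : exists s : seq coset_space, [set g : coset_map |
    forall A, A \in s -> f A = g A] `<=` B.
  by have [x xs] := fG s; exists (theta x); split; [exists x|exact: sB].
pose F : set_system coset_map := filter_from (setT : set (seq coset_space))
  (fun s => [set g : coset_map | forall A, A \in s -> f A = g A]).
have FF : Filter F.
  apply: filter_from_filter; first by exists [::].
  move=> s t _ _; exists (s ++ t) => // g gst.
  by split=> A As; apply: gst; rewrite mem_cat As ?orbT.
have /(_ B Bf)[s _ sB] : F --> f.
  by apply/coset_map_cvgP => A; exists [:: A] => // g /= ->; rewrite ?mem_head.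
by exists s.
Qed.

Lemma Gbar_set1 : Gbar_set id.
Proof. by apply/Gbar_setP => s; exists 1%g => A _; rewrite theta1. Qed.

Lemma Gbar_setM f g : Gbar_set f -> Gbar_set g -> Gbar_set (f \o g).
Proof.
move=> /Gbar_setP fG /Gbar_setP gG; apply/Gbar_setP => s.
have [y ys] := gG s; have [x xs] := fG (map g s); exists (x * y)%g => A As.
by rewrite thetaM /= -ys// xs// map_f.
Qed.

Lemma Gbar_set_inj f : Gbar_set f -> injective f.
Proof.
move=> /Gbar_setP fG A B.
have [x xs] := fG [:: A; B]; rewrite !xs ?inE ?eqxx ?orbT//.
exact: theta_inj.
Qed.

Hypothesis HH : hecke_pair H.

Lemma orbit_finite (x : G) :
  finite_set [set theta h (theta x coset1) | h in H].
Proof.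
have [F finF HxH] := HH.2 x.
apply: (@sub_finite_set _ _ [set theta y coset1 | y in F]); last first.
  exact: finite_image.
move=> _ [h Hh <-]; rewrite -[theta h _]/((theta h \o theta x) coset1) -thetaM.
have : dcoset H x (h * x)%g.
  exists h => //; exists 1%g; last by rewrite mulg1.
  by apply/set_mem; have [] := HH.1.
rewrite HxH => -[y Fy [k Hk hxE]]; exists y => //.
rewrite -hxE thetaM /=; congr (theta y _); apply: val_inj => /=.
rewrite lcosetM mulg1 /lcoset.
have HM := group_closedM HH.1; have HV := group_closedV HH.1.
apply/seteqP; split=> _ [z Hz <-].
  exists (k^-1 * z)%g; last by rewrite mulVKg mul1g.
  by apply/set_mem/HM; [apply: HV|]; exact/mem_set.
exists (k * z)%g; last by rewrite mul1g.
by apply/set_mem/HM; exact/mem_set.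
Qed.

Lemma theta_surj (A : coset_space) : exists x, A = theta x coset1.
Proof.
case: (set_valP A) => x _ xA; exists x; apply: val_inj => /=.
by rewrite lcosetM mulg1.
Qed.

Lemma theta_coset1 x : theta x coset1 = coset1 -> H x.
Proof.
move=> /(congr1 val) /=; rewrite lcosetM mulg1 => xH.
have H1 := set_mem HH.1.1.
have : lcoset 1%g H x by rewrite -xH; exists 1%g; rewrite ?mulg1.
by case=> h Hh <-; rewrite mul1g.
Qed.

Lemma Gbar_set_surj f : Gbar_set f -> forall B, exists A, f A = B.
Proof.
move=> fG B; have /Gbar_setP fG' := fG.
have [x xs] := fG' [:: coset1].
have fx : f coset1 = theta x coset1 by rewrite xs ?mem_head.
have [y yB] := theta_surj (theta x^-1%g B).
pose O := [set theta h (theta y coset1) | h in H].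
have finO : finite_set O := orbit_finite y.
pose f' : coset_map := theta x^-1%g \o f.
have f'_inj : injective f'.
  by apply: inj_comp => //; [exact: theta_inj|exact: Gbar_set_inj].
have f'O : f' @` O `<=` O.
  move=> _ [A [h Hh <-] <-].
  have [z zs] := fG' [:: coset1; theta h (theta y coset1)].
  have Hxz : H (x^-1 * z)%g.
    apply: theta_coset1; rewrite thetaM /= -zs ?mem_head//.
    by rewrite fx thetaK.
  exists (x^-1 * z * h)%g.
    by apply/set_mem/(group_closedM HH.1); exact/mem_set.
  by rewrite !thetaM /= -zs ?inE ?eqxx ?orbT.
have f'OE : f' @` O = O.
  have finf'O : finite_set (f' @` O) := finite_image _ finO.
  apply: fset_set_inj => //; apply/eqP; rewrite eqEfcard.
  rewrite fset_set_image// card_imfset//= leqnn andbT -fset_set_image//.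
  by rewrite -fset_set_sub.
have [A _ fA] : (f' @` O) (theta x^-1%g B).
  by rewrite f'OE yB; exists 1%g; [exact/set_mem/HH.1.1|rewrite theta1].
by exists A; apply: (@theta_inj x^-1%g).
Qed.

Definition ginv (f : coset_map) : coset_map :=
  fun B => xget coset1 [set A | f A = B].

Lemma ginvKV f : Gbar_set f -> cancel (ginv f) f.
Proof.
move=> fG B; apply: (@xgetPex _ coset1 [set A | f A = B]).
exact: Gbar_set_surj.
Qed.

Lemma ginvK f : Gbar_set f -> cancel f (ginv f).
Proof. by move=> fG A; apply: (Gbar_set_inj fG); rewrite ginvKV. Qed.

Lemma Gbar_setV f : Gbar_set f -> Gbar_set (ginv f).
Proof.
move=> fG; have /Gbar_setP fG' := fG; apply/Gbar_setP => s.
have [x xs] := fG' (map (ginv f) s); exists x^-1%g => A As.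
by apply: (@theta_inj x); rewrite -xs ?map_f// ginvKV// -{1}(invgK x) thetaK.
Qed.



(* The Hecke condition is an argument because it is what makes every element of
   the closure invertible, hence the closure a group. *)
Definition schlichting of hecke_pair H : Type := set_type Gbar_set.
End Schlichting.
Arguments theta {G} H x.
Arguments Gbar_set {G} H.

Section SchlichtingGroup.
Context {G : groupType} {H : set G} (HH : hecke_pair H).
Local Notation Gbar := (schlichting HH).

HB.instance Definition _ := Choice.on Gbar.
HB.instance Definition _ := Topological.on Gbar.

Definition sch_mk (f : coset_map H) (fG : Gbar_set H f) : Gbar :=
  exist (fun f => f \in Gbar_set H) f (mem_set fG).

Definition sch_one : Gbar := sch_mk (@Gbar_set1 G H).
Definition sch_mul (f g : Gbar) : Gbar :=
  sch_mk (Gbar_setM (set_valP f) (set_valP g)).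
Definition sch_inv (f : Gbar) : Gbar := sch_mk (Gbar_setV HH (set_valP f)).

Lemma sch_mulA : associative sch_mul.
Proof. by move=> f g h; apply: val_inj. Qed.
Lemma sch_mul1 : left_id sch_one sch_mul.
Proof. by move=> f; apply: val_inj. Qed.
Lemma sch_mulr1 : right_id sch_one sch_mul.
Proof. by move=> f; apply: val_inj. Qed.
Lemma sch_mulV : left_inverse sch_one sch_inv sch_mul.
Proof.
by move=> f; apply: val_inj; apply/funext => A; exact: (ginvK HH (set_valP f)).
Qed.
Lemma sch_mulrV : right_inverse sch_one sch_inv sch_mul.
Proof.
by move=> f; apply: val_inj; apply/funext => A; exact: (ginvKV HH (set_valP f)).
Qed.

HB.instance Definition _ :=
  isGroup.Build Gbar sch_mulA sch_mul1 sch_mulr1 sch_mulV sch_mulrV.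
HB.instance Definition _ := isPointed.Build Gbar sch_one.

Lemma sch_nbhs (f : Gbar) A : nbhs f [set g : Gbar | val g A = val f A].
Proof.
have /(_ _ (nbhs_coset_map (val f) A)) :=
  @initial_continuous _ _ (set_val : set_type (Gbar_set H) -> _) f.
by [].
Qed.

Lemma sch_cvg (T : Type) (F : set_system T) (u : T -> Gbar) (f : Gbar) :
  Filter F -> (forall A, \forall t \near F, val (u t) A = val f A) ->
  u @ F --> f.
Proof.
move=> FF uf B [_ [[V oV <-] Vf] VB].
have /(_ V) : val \o u @ F --> val f.
  by apply/coset_map_cvgP => A; exact: uf.
move=> /(_ (open_nbhs_nbhs (conj oV Vf))); rewrite /nbhs /=.
by apply: filterS => t Vt; exact: VB.
Qed.

Lemma sch_mul_continuous : continuous (fun xy : Gbar * Gbar => (xy.1 * xy.2)%g).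
Proof.
move=> [f g]; apply: sch_cvg => A.
exists ([set f' : Gbar | val f' (val g A) = val f (val g A)],
        [set g' : Gbar | val g' A = val g A]); first by split; exact: sch_nbhs.
by move=> [f' g'] [/= ff' gg']; rewrite -ff' -gg'.
Qed.

Lemma sch_inv_continuous : continuous (fun x : Gbar => x^-1%g).
Proof.
move=> f; have FF : Filter (nbhs f) := nbhs_filter f.
apply: (sch_cvg FF) => A.
apply: (@filterS _ _ FF _ _ _ (sch_nbhs f (val f^-1%g A))) => g /= gA.
apply: (Gbar_set_inj (set_valP g)).
transitivity A; first exact: (ginvKV HH (set_valP g) A).
transitivity (val f (val f^-1%g A)); last exact: esym gA.
exact: esym (ginvKV HH (set_valP f) A).
Qed.

HB.instance Definition _ :=
  isTopologicalGroup.Build Gbar sch_mul_continuous sch_inv_continuous.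

Definition Hbar : set Gbar :=
  [set f | closure [set theta H h | h in H] (val f : coset_map H)].
End SchlichtingGroup.
Arguments Hbar {G H} HH.

Notation borel T := (g_sigma_algebraType (@open T)).

Section Haar.
Context {R : realType} {T : topGroupType}.
Implicit Type mu : {measure set (borel T) -> \bar R}.

(* finite on compacts, outer regular on Borel sets, inner regular on open sets *)
Definition radon mu : Prop :=
  [/\ forall K : set T, compact K -> (mu K < +oo)%E,
      forall A : set (borel T), measurable A ->
        mu A = ereal_inf [set mu U | U in [set U : set T | open U /\ A `<=` U]]
    & forall U : set T, open U ->
        mu U = ereal_sup [set mu K | K in [set K : set T | compact K /\ K `<=` U]]].

Definition left_haar mu : Prop :=
  [/\ radon mu, mu setT != 0%E
    & forall (x : T) (A : set (borel T)), measurable A ->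
        mu (lcoset (x : T) A) = mu A].

(* The convention is mu(Ax) = Delta(x) mu(A), the one for which
   f^*(x) = conj(f(x^-1)) Delta(x^-1) is isometric for the L^1-norm and
   Delta = L(x) / L(x^-1) on a Hecke pair with H compact open. *)
Definition modular_function mu (Delta : T -> R) : Prop :=
  (forall x, 0 < Delta x) /\
  forall (x : T) (A : set (borel T)), measurable A ->
    mu [set (a * x)%g | a in (A : set T)] = ((Delta x)%:E * mu A)%E.
End Haar.

(* The complex numbers; the library attaches a topology to R[i] only when it is
   seen as a numClosedFieldType. *)
Definition Cplx (R : realType) : numClosedFieldType := R[i].

Section FunctionAlgebras.
Context {R : realType} {T : topGroupType}.
Implicit Types (f g : T -> Cplx R) (x : T) (mu : {measure set (borel T) -> \bar R}).

Definition Cc : set (T -> Cplx R) :=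
  [set f | continuous f /\ compact (closure [set x | f x != 0])].

Definition Cintegral mu f : Cplx R :=
  ((\int[mu]_t complex.Re (f t)) +i* (\int[mu]_t complex.Im (f t)))%C.

Definition convol mu f g : T -> Cplx R :=
  fun x => Cintegral mu (fun t => f t * g (t^-1 * x)%g).

Definition star (Delta : T -> R) f : T -> Cplx R :=
  fun x => (f x^-1%g)^* * ((Delta x^-1%g)%:C)%C.

Definition lact x f : T -> Cplx R := fun s => f (x^-1 * s)%g.

(* p x p, for x acting on C_c(T) as a multiplier *)
Definition compress mu (p : T -> Cplx R) x : T -> Cplx R := convol mu p (lact x p).

Definition L1norm mu f : \bar R := (\int[mu]_t (Normc.normc (f t))%:E)%E.

Definition corner mu (p : T -> Cplx R) : set (T -> Cplx R) :=
  [set convol mu (convol mu p f) p | f in Cc].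
End FunctionAlgebras.

Section HeckeAlgebra.
Context {R : realType} {G : groupType} (H : set G).
Implicit Types (f g : G -> Cplx R) (x : G).

Definition hecke_Delta x : R := (hecke_L H x)%:R / (hecke_L H x^-1%g)%:R.

Definition hecke_algebra : set (G -> Cplx R) :=
  [set f | exists (s : seq G) (c : G -> Cplx R),
     f = \sum_(x <- s) c x *: \1_(dcoset H x)].

(* A chosen element of the coset A. The sums below run over y = coset_repr A; the
   summands are constant on A whenever f and g are in [hecke_algebra]. *)
Definition coset_repr (A : set G) : G := xget 1%g A.

Definition hecke_conv f g : G -> Cplx R := fun x =>
  \sum_(A \in lcosets setT H) f (coset_repr A) * g ((coset_repr A)^-1 * x)%g.

Definition hecke_star f : G -> Cplx R :=
  fun x => (f x^-1%g)^* * ((hecke_Delta x^-1%g)%:C)%C.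

Definition l1norm f : \bar R :=
  (\esum_(A in lcosets setT H) (Normc.normc (f (coset_repr A)))%:E)%E.
End HeckeAlgebra.

(* Main.v *)
(** Let [K] be any open compact subgroup of a topological group with a left Haar
    measure [mu] such that [mu K = 1].  Left invariance of the measure makes
    [p * f] and [(p * f) * p] left [K]-invariant, hence locally constant, so an
    element of the corner is bi-[K]-invariant, and compactness of the support
    leaves only finitely many double cosets.  Conversely [p * f * p = f] for
    bi-[K]-invariant [f].  The integral of a right [K]-invariant function
    supported on finitely many left cosets is the sum of its values on these
    cosets, which turns convolution and the L^1-norm into the Hecke operations.
    Splitting [K x K] into left and into right cosets of [K] gives
    [L(x) = L(x^-1) Delta(x)], and [(p x p)(h x k) = mu (h K_x) = 1 / L(x)].

    In the Schlichting completion, [Hbar] is the stabiliser of the coset [H],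
    hence open; inner regularity and [mu Hbar = 1] make it compact. *)
Require Import Defs.
From mathcomp Require Import all_boot all_order all_algebra.
From mathcomp Require Import all_classical all_reals all_analysis.
From mathcomp Require Import measurable_realfun finmap complex lra.

Import Order.TTheory GRing.Theory Num.Theory.
Import numFieldNormedType.Exports.

Local Open Scope classical_set_scope.
Local Open Scope ring_scope.

(** * Left cosets and double cosets of a subgroup *)

Section SubgroupCosets.
Context {G : groupType} {H : set G} (HG : group_closed (mem H)).
Implicit Types (x y h k : G) (A : set G).

Lemma subgroup1 : H 1%g. Proof. exact/set_mem/HG.1. Qed.

Lemma subgroupM {h k} : H h -> H k -> H (h * k)%g.
Proof.
by move=> ? ?; apply/set_mem/(group_closedM HG); exact/mem_set.
Qed.

Lemma subgroupV {h} : H h -> H h^-1%g.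
Proof. by move=> ?; apply/set_mem/(group_closedV HG); exact/mem_set. Qed.

Lemma subgroupVE h : H h^-1%g <-> H h.
Proof. by split=> [/subgroupV|/subgroupV//]; rewrite invgK. Qed.

Lemma subgroupMl {h k} : H h -> H (h * k)%g <-> H k.
Proof.
move=> Hh; split=> [/(subgroupM (subgroupV Hh))|]; first by rewrite mulKg.
exact: subgroupM.
Qed.

Lemma subgroupMr {h k} : H h -> H (k * h)%g <-> H k.
Proof.
move=> Hh; split=> [/subgroupM/(_ (subgroupV Hh))|/subgroupM/(_ Hh)//].
by rewrite mulgK.
Qed.

Lemma lcosetP {A} {x y} : lcoset x A y <-> A (x^-1 * y)%g.
Proof.
split=> [[h Ah <-]|Axy]; first by rewrite mulKg.
by exists (x^-1 * y)%g => //; rewrite mulVKg.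
Qed.

Lemma lcoset_self x : lcoset x H x.
Proof. by apply/lcosetP; rewrite mulVg; exact: subgroup1. Qed.

Lemma lcoset_eq {x y} : lcoset x H y -> lcoset x H = lcoset y H.
Proof.
move=> /lcosetP Hxy; apply/seteqP; split=> z /lcosetP Hz; apply/lcosetP.
  rewrite -(mulVKg x z) mulgA; apply: subgroupM => //.
  by rewrite -[X in H X]invgK invgM invgK; exact: subgroupV.
by rewrite -(mulVKg y z) mulgA; exact: subgroupM.
Qed.

Lemma lcoset_repr {A D x} : lcosets D H A -> A x -> A = lcoset x H.
Proof. by case=> y _ <-; exact: lcoset_eq. Qed.

Lemma coset_reprP {A D} : lcosets D H A -> A (coset_repr A).
Proof.
by case=> y _ <-; apply: (@xgetPex _ 1%g); exists y; exact: lcoset_self.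
Qed.

Lemma trivIset_lcosets D : trivIset (lcosets D H) id.
Proof.
move=> A B DA DB [x [Ax Bx]].
by rewrite (lcoset_repr DA Ax) (lcoset_repr DB Bx).
Qed.

Lemma bigcup_lcosets D : (forall x h, D x -> H h -> D (x * h)%g) ->
  \bigcup_(A in lcosets D H) A = D.
Proof.
move=> DH; apply/seteqP; split=> [z [_ [x Dx <-] [h Hh <-]]|x Dx];
  first exact: DH.
by exists (lcoset x H); [exists x|exact: lcoset_self].
Qed.

Lemma dcoset_self x : dcoset H x x.
Proof.
have H1 := subgroup1; exists 1%g => //; exists 1%g => //.
by rewrite mul1g mulg1.
Qed.

Lemma dcosetM {x y h k} :
  H h -> H k -> dcoset H x (h * y * k)%g <-> dcoset H x y.
Proof.
move=> Hh Hk; split=> -[h' Hh' [k' Hk' E]].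
  exists (h^-1 * h')%g; first by apply: subgroupM => //; exact: subgroupV.
  exists (k' * k^-1)%g; first by apply: subgroupM => //; exact: subgroupV.
  rewrite mulgA; apply: (canLR (mulgK _)); rewrite -2!mulgA.
  by apply: (canLR (mulKg _)); rewrite !mulgA E.
exists (h * h')%g; first exact: subgroupM.
by exists (k' * k)%g; [exact: subgroupM|rewrite -E !mulgA].
Qed.

Lemma dcosetMl {x y h} : H h -> dcoset H x (h * y)%g <-> dcoset H x y.
Proof.
move=> Hh; rewrite -(mulg1 (h * y)%g).
by apply: dcosetM => //; exact: subgroup1.
Qed.

Lemma dcosetMr {x y k} : H k -> dcoset H x (y * k)%g <-> dcoset H x y.
Proof.
move=> Hk; rewrite -(mul1g (y * k)%g) mulgA.
by apply: dcosetM => //; exact: subgroup1.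
Qed.

Lemma dcosetV {x y} : dcoset H x^-1%g y^-1%g <-> dcoset H x y.
Proof.
suff V u v : dcoset H u v -> dcoset H u^-1%g v^-1%g.
  by split=> /V //; rewrite !invgK.
case=> h Hh [k Hk <-]; rewrite !invgM mulgA; apply/dcosetM;
  try exact: subgroupV.
exact: dcoset_self.
Qed.

Lemma bigcup_lcosets_dcoset x :
  \bigcup_(A in lcosets (dcoset H x) H) A = dcoset H x.
Proof. by apply: bigcup_lcosets => y h Hy Hh; exact/dcosetMr. Qed.

Lemma group_closedI_conjg x :
  group_closed (mem (H `&` conjg_set x H)).
Proof.
have cP z : conjg_set x H z <-> H (x^-1 * z * x)%g.
  split=> [[h Hh <-]|Hz]; first by rewrite !mulgA mulVg mul1g mulgVK.
  by exists (x^-1 * z * x)%g => //; rewrite !mulgA mulgV mul1g mulgK.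
split; first apply/mem_set.
  by split; [exact: subgroup1|apply/cP; rewrite mulg1 mulVg; exact: subgroup1].
move=> a b /set_mem[Ha /cP xa] /set_mem[Hb /cP xb]; apply/mem_set; split.
  by apply: subgroupM => //; exact: subgroupV.
apply/cP; have := subgroupM xa (subgroupV xb).
by rewrite !invgM invgK !mulgA mulgK.
Qed.

(** Conjugating by [x] turns [h^-1 * k] in [x H x^-1] into [(h x)^-1 * (k x)] in [H]. This is the
    orbit-stabiliser correspondence for [H] acting on the left cosets inside [H x H]; it serves both
    to count these cosets and to evaluate [p x p]. *)
Lemma stab_lcosetP {x h k} : H h -> H k ->
  lcoset h (H `&` conjg_set x H) k <-> lcoset (h * x)%g H (k * x)%g.
Proof.
move=> Hh Hk; split=> /lcosetP.
  case=> _ [z Hz E]; apply/lcosetP; rewrite invgM mulgA -[X in H (X *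
    _)%g]mulgA.
  by rewrite -E !mulgA mulVg mul1g mulgVK.
move=> Hz; apply/lcosetP; split.
  by apply: subgroupM => //; exact: subgroupV.
exists (x^-1 * (h^-1 * k) * x)%g; last by rewrite !mulgA mulgV mul1g mulgK.
by move: Hz; rewrite invgM !mulgA.
Qed.

End SubgroupCosets.

(** * Open and compact open subgroups of a topological group *)

Section OpenSubgroup.
Context {T : topGroupType} {K : set T} (KG : group_closed (mem K)).
Hypothesis oK : open K.
Implicit Types (x y h k : T) (A : set T).

Lemma cvgMg (U : Type) (F : set_system U) (FF : Filter F) (f g : U -> T) x y :
  f @ F --> x -> g @ F --> y -> (f t * g t)%g @[t --> F] --> (x * y)%g.
Proof.
exact: (@continuous2_cvg U T T T F FF f g (fun a b => (a * b)%g) x y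
  (@mulg_continuous T (x, y))).
Qed.

Lemma mulgl_continuous x : continuous (fun t : T => (x * t)%g).
Proof. by move=> t; apply: cvgMg; [exact: cvg_cst|exact: cvg_id]. Qed.

Lemma mulgr_continuous x : continuous (fun t : T => (t * x)%g).
Proof. by move=> t; apply: cvgMg; [exact: cvg_id|exact: cvg_cst]. Qed.

Lemma open_lcoset x : open (lcoset x K).
Proof.
have -> : lcoset x K = (fun t => x^-1 * t)%g @^-1` K.
  by apply/seteqP; split=> y /lcosetP.
by apply: open_comp oK => t _; exact: mulgl_continuous.
Qed.

Lemma open_mulr_closed A : (forall x k, A x -> K k -> A (x * k)%g) -> open A.
Proof.
move=> AK; rewrite -(bigcup_lcosets KG _ AK).
by apply: bigcup_open => _ [x _ <-]; exact: open_lcoset.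
Qed.

(** Inversion is continuous and exchanges left and right invariance. *)
Lemma open_mull_closed A : (forall x k, A x -> K k -> A (k * x)%g) -> open A.
Proof.
move=> AK; have -> : A = (fun t => t^-1)%g @^-1` [set y | A y^-1%g].
  by apply/seteqP; split=> y /=; rewrite invgK.
apply: open_comp => [t _|]; first exact: invg_continuous.
apply: open_mulr_closed => x k /= Ax Kk; rewrite invgM.
by apply: AK => //; exact: subgroupV.
Qed.

(** The complement is again right [K]-invariant, because [K] contains inverses, and is therefore
    open. *)
Lemma closed_mulr_closed A : (forall x k, A x -> K k -> A (x * k)%g) -> closed
  A.
Proof.
move=> AK; rewrite -(setCK A); apply/open_closedC/open_mulr_closed.
move=> x k + Kk; apply: contra_not => /AK/(_ (subgroupV KG Kk)).
by rewrite mulgK.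
Qed.

(** The open cosets [x K] with [x] in [A] cover [A]. A coset meeting a member of a finite subcover
    equals it, so the subcover already contains every coset. *)
Lemma finite_lcosets A : compact A -> finite_set (lcosets A K).
Proof.
rewrite compact_cover => /(_ T A (lcoset^~ K)) [|x Ax|D DA AD].
- by move=> ? _; exact: open_lcoset.
- by exists x => //; exact: lcoset_self.
apply: (@sub_finite_set _ _ [set lcoset x K | x in [set` D]]); last first.
  exact/finite_image/finite_fset.
move=> _ [x /AD[y Dy xy] <-]; exists y => //.
exact: (lcoset_eq KG xy).
Qed.

Hypothesis cK : compact K.

Lemma compact_dcoset x : compact (dcoset K x).
Proof.
have -> : dcoset K x = [set (hk.1 * x * hk.2)%g | hk in K `*` K].
  apply/seteqP; split=> [_ [h Kh [k Kk <-]]|_ [[h k] [Kh Kk] <-]].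
    by exists (h, k).
  by exists h => //; exists k.
apply: continuous_compact (compact_setX cK cK).
apply: continuous_subspaceT => -[h k].
apply: cvgMg; last exact: cvg_snd.
by apply: cvgMg; [exact: cvg_fst|exact: cvg_cst].
Qed.

Lemma finite_lcosets_dcoset x : finite_set (lcosets (dcoset K x) K).
Proof. exact/finite_lcosets/compact_dcoset. Qed.

End OpenSubgroup.

(** * Measures of cosets, the index [L(x)] and the modular function *)

Lemma card_fset_set_image {I J : choiceType} (f : I -> J) (A : set I) :
  finite_set A -> {in A &, injective f} ->
  #|` fset_set (f @` A)|%fset = #|` fset_set A|%fset.
Proof.
move=> finA injf; rewrite fset_set_image// card_in_imfset// => i j.
by rewrite !in_fset_set//; exact: injf.
Qed.

Section InvariantMeasure.
Context {R : realType} {T : topGroupType}.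
Context {mu : {measure set (borel T) -> \bar R}}.
Implicit Types (x y h k : T) (A U : set T).

Lemma measurable_open U : open U -> measurable (U : set (borel T)).
Proof. exact: sub_sigma_algebra. Qed.

Lemma measure_bigcup_const (F : set (set T)) (c : R) :
  finite_set F -> trivIset F id ->
  (forall A, F A -> measurable (A : set (borel T)) /\ mu A = c%:E) ->
  mu (\bigcup_(A in F) A) = ((#|` fset_set F|%fset)%:R * c)%:E.
Proof.
move=> finF tF Fc.
rewrite (@measure_fin_bigcup _ _ _ mu _ F id)//; last by move=> A /Fc[].
rewrite fsbig_finite//= (eq_big_seq (fun=> c%:E)); last first.
  by move=> A; rewrite in_fset_set// => /set_mem/Fc[].
by rewrite sumEFin big_const_seq count_predT iter_addr_0 mulr_natl.
Qed.

Context {K : set T} (KG : group_closed (mem K)) (oK : open K) (cK : compact K).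
Hypothesis mu_lcoset : forall x (A : set (borel T)),
  measurable A -> mu (lcoset (x : T) A) = mu A.
Hypothesis muK : mu K = 1%E.

Lemma mu_dcoset x : mu (dcoset K x) = (hecke_L K x)%:R%:E.
Proof.
rewrite -(bigcup_lcosets_dcoset KG) (measure_bigcup_const _ 1) ?mulr1//.
- exact: finite_lcosets_dcoset.
- exact: trivIset_lcosets.
- move=> _ [y _ <-]; split; first by apply: measurable_open; exact: open_lcoset.
  by rewrite mu_lcoset//; exact: measurable_open.
Qed.

Let stab x := K `&` conjg_set x K.

Lemma open_stab x : open (stab x).
Proof.
apply: openI => //.
have -> : conjg_set x K = (fun t => x^-1 * t)%g @^-1` ((fun t => t * x)%g @^-1`
  K).
  apply/seteqP; split=> [_ [h Kh <-]|y /= Ky].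
    by rewrite /= !mulgA mulVg mul1g mulgVK.
  by exists (x^-1 * y * x)%g => //; rewrite !mulgA mulgV mul1g mulgK.
apply: open_comp => [t _|]; first exact: mulgl_continuous.
by apply: open_comp oK => t _; exact: mulgr_continuous.
Qed.

Lemma finite_lcosets_stab x : finite_set (lcosets K (stab x)).
Proof.
by apply: finite_lcosets cK; [exact: group_closedI_conjg|exact: open_stab].
Qed.

(** The map sending [h (stab x)] to [h x K] is a bijection onto the left cosets in [K x K], by
    [stab_lcosetP]. *)
Lemma hecke_L_index x : hecke_L K x = subgroup_index K (stab x).
Proof.
have sG := group_closedI_conjg KG x.
rewrite /hecke_L /subgroup_index.
rewrite -(@card_fset_set_image _ _ (fun A => lcoset (coset_repr A * x)%g K)
  (lcosets K (stab x))); first last.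
- move=> A B /set_mem As /set_mem Bs AB.
  (* Chosen representatives stay in [K] because [stab x] is contained in [K]. *)
  have KAs C : lcosets K (stab x) C -> K (coset_repr C).
    move=> Cs; have := coset_reprP sG Cs; case: Cs => h Kh <- [z [Kz _] <-].
    exact: subgroupM.
  rewrite (lcoset_repr sG As (coset_reprP sG As)).
  rewrite (lcoset_repr sG Bs (coset_reprP sG Bs)).
  apply: (lcoset_eq sG); apply/(stab_lcosetP KG); [exact: KAs|exact: KAs|].
  by rewrite AB; exact: lcoset_self.
- exact: finite_lcosets_stab.
- congr (#|` fset_set _|)%fset; apply/seteqP;
  split=> [_ [_ [h Kh [k Kk <-]] <-]|].
    have hs : lcosets K (stab x) (lcoset h (stab x)) by exists h.
    exists (lcoset h (stab x)); first exact: hs.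
    have [z [Kz _] zE] := coset_reprP sG hs.
    have Kr : K (coset_repr (lcoset h (stab x))) by rewrite -zE;
      exact: subgroupM.
    transitivity (lcoset (h * x)%g K).
      by apply/esym/(lcoset_eq KG)/(stab_lcosetP KG) => //;
        exact: (coset_reprP sG hs).
    by apply: (lcoset_eq KG); apply/lcosetP; rewrite mulKg.
  move=> _ [_ [h Kh <-] <-]; exists (coset_repr (lcoset h (stab x)) * x)%g =>
    //.
  have hs : lcosets K (stab x) (lcoset h (stab x)) by exists h.
  have [z [Kz _] <-] := coset_reprP sG hs.
  apply/(dcosetMl KG); first exact: subgroupM.
  exact: dcoset_self.
Qed.

Lemma hecke_L_gt0 x : (0 < hecke_L K x)%N.
Proof.
rewrite /hecke_L cardfs_gt0; apply/fset0Pn; exists (lcoset x K).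
rewrite in_fset_set; last exact: finite_lcosets_dcoset.
by apply/mem_set; exists x => //; exact: dcoset_self.
Qed.

(** [K] has measure 1 and is the disjoint union of [L(x)] left translates of [stab x], all of the
    same measure. *)
Lemma mu_stab x : mu (stab x) = ((hecke_L K x)%:R^-1)%:E.
Proof.
have sG := group_closedI_conjg KG x.
have mstab : measurable (stab x : set (borel T)) by apply: measurable_open;
  exact: open_stab.
(* Finiteness makes [mu (stab x)] a real number, so that the equation [L(x) * mu (stab x) = 1] can
   be solved in [R]. *)
have finmu : mu (stab x) \is a fin_num.
  rewrite ge0_fin_numE//; apply: (@le_lt_trans _ _ (mu K)).
    apply: le_measure; [exact/mem_set| |by move=> ? []].
    by apply/mem_set; apply: measurable_open.
  by rewrite muK ltry.
have /= := muK; rewrite -{1}(bigcup_lcosets sG K); last first.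
  by move=> y h Ky [Kh _]; exact: subgroupM.
rewrite (measure_bigcup_const _ (fine (mu (stab x)))).
- move=> [] E; rewrite -(fineK finmu); congr (_%:E).
  have L0 : (hecke_L K x)%:R != 0 :> R by rewrite pnatr_eq0 -lt0n hecke_L_gt0.
  by apply: (mulfI L0); rewrite divff// hecke_L_index; exact: E.
- exact: finite_lcosets_stab.
- exact: trivIset_lcosets.
- move=> _ [y _ <-]; split; first by apply: measurable_open;
  exact: open_lcoset (open_stab _) _.
  by rewrite mu_lcoset// fineK.
Qed.

Lemma mu_stab_lcoset h x : mu (lcoset h (stab x)) = ((hecke_L K x)%:R^-1)%:E.
Proof.
by rewrite mu_lcoset ?mu_stab//; apply: measurable_open; exact: open_stab.
Qed.

(** The measure of [K x K] is computed twice. Its left cosets have measure 1 and number [L(x)]. Its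
    right cosets [K y] are the inverses of the left cosets in [K x^-1 K], so they number [L(x^-1)],
    and each has measure [Delta y = Delta x]. *)
Lemma modular_hecke_Delta (Delta : T -> R) :
  (forall (x : T) (A : set (borel T)), measurable A ->
    mu [set (a * x)%g | a in (A : set T)] = ((Delta x)%:E * mu A)%E) ->
  forall x, Delta x = hecke_Delta K x.
Proof.
move=> DeltaP x.
have mK : measurable (K : set (borel T)) by exact: measurable_open.
have muKx y : mu [set (a * y)%g | a in K] = (Delta y)%:E.
  by rewrite DeltaP// muK mule1.
(* Here [K k = K], so right translation by [k] preserves a set of measure 1. *)
have DeltaK k : K k -> Delta k = 1.
  move=> Kk; suff : (Delta k)%:E = 1%E :> \bar R by case.
  rewrite -muKx -muK; congr (mu _); apply/seteqP; split=> [_ [a Ka <-]|a Ka].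
    exact: subgroupM.
  by exists (a * k^-1)%g; rewrite ?mulgVK//; apply/subgroupM/subgroupV.
have mKx y : measurable ([set (a * y)%g | a in K] : set (borel T)).
  apply: measurable_open; apply: (open_mull_closed KG oK) => _ k [a Ka <-] Kk.
  by exists (k * a)%g; rewrite ?mulgA//; exact: subgroupM.
(* For [y = h x k] the left factor is absorbed: [K y = (K x) k]. *)
have Delta_dcoset y : dcoset K x y -> Delta y = Delta x.
  case=> h Kh [k Kk <-]; suff : (Delta (h * x * k)%g)%:E = (Delta x)%:E by case.
  transitivity (mu [set (b * k)%g | b in [set (a * x)%g | a in K]]); last first.
    by rewrite DeltaP// muKx DeltaK// mul1e.
  rewrite -muKx; congr (mu _); rewrite image_comp.
  apply/seteqP; split=> [_ [a Ka <-]|_ [a Ka <-]].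
    by exists (a * h)%g; rewrite /= ?mulgA//; exact: subgroupM.
  exists (a * h^-1)%g; first by apply/subgroupM/subgroupV.
  by rewrite !mulgA mulgVK.
(* On sets, inversion is an injective map carrying the left coset [y K] to the right coset
   [K y^-1]. *)
pose inv (A : set T) := [set a^-1%g | a in A].
have invI : injective inv.
  apply: (can_inj (g := inv)) => A; rewrite /inv image_comp.
  by rewrite (eq_imagel (f' := id)) ?image_id// => a _ /=; rewrite invgK.
have finV := finite_lcosets_dcoset KG oK cK x^-1%g.
have : mu (\bigcup_(A in inv @` lcosets (dcoset K x^-1%g) K) A) =
    ((hecke_L K x^-1%g)%:R * Delta x)%:E.
  rewrite (measure_bigcup_const _ (Delta x)).
  - by rewrite card_fset_set_image// => A B _ _; exact: invI.
  - exact: finite_image.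
  - move=> _ _ [A Ax <-] [B Bx <-] [_ [[a Aa <-] [b Bb /invg_inj ba]]]; subst b.
    by congr inv; apply: (trivIset_lcosets KG _ _ _ Ax Bx); exists a.
  - move=> _ [_ [y xy <-] <-].
    have -> : inv (lcoset y K) = [set (a * y^-1)%g | a in K].
      rewrite /inv /lcoset image_comp; apply/seteqP; split=> _ [k Kk <-].
        by exists k^-1%g; rewrite /= ?invgM//; exact: subgroupV.
      by exists k^-1%g; rewrite /= ?invgM ?invgK//; exact: subgroupV.
    split; first exact: mKx.
    by rewrite muKx Delta_dcoset//; apply/(dcosetV KG); rewrite invgK.
have -> : \bigcup_(A in inv @` lcosets (dcoset K x^-1%g) K) A = dcoset K x.
  rewrite bigcup_image -(image_bigcup (lcosets _ K) id) (bigcup_lcosets_dcoset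
    KG).
  apply/seteqP; split=> [_ [y xy <-]|y xy]; first by apply/(dcosetV KG);
    rewrite invgK.
  by exists y^-1%g; [exact/(dcosetV KG)|rewrite invgK].
rewrite mu_dcoset => -[E]; rewrite /hecke_Delta E mulrAC divff ?mul1r//.
by rewrite pnatr_eq0 -lt0n hecke_L_gt0.
Qed.

End InvariantMeasure.

(** * Integrals of functions constant on left cosets *)

Lemma complex_sum {R : realType} {I : Type} (s : seq I) (F : I -> Cplx R) :
  \sum_(i <- s) F i =
  ((\sum_(i <- s) complex.Re (F i)) +i* (\sum_(i <- s) complex.Im (F i)))%C.
Proof.
elim: s => [|i s IHs]; first by rewrite !big_nil.
by rewrite !big_cons IHs; case: (F i).
Qed.

Lemma normc_ge0 {R : realType} (z : Cplx R) : 0 <= Normc.normc z.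
Proof. by case: z => a b; exact: sqrtr_ge0. Qed.

(** Reduces real integrals to those of two nonnegative real-valued functions, with no integrability
    condition to check. *)
Lemma Rintegral_max {d} {T : measurableType d} {R : realType}
    (mu : {measure set T -> \bar R}) (g : T -> R) :
  \int[mu]_t g t = fine (\int[mu]_t (Num.max (g t) 0)%:E -
                         \int[mu]_t (Num.max (- g t) 0)%:E)%E.
Proof.
rewrite /Rintegral integralE; congr (fine (_ - _)); apply: eq_integral => t _.
  by rewrite funeposE EFin_max.
by rewrite funenegE EFin_max.
Qed.

Section CosetIntegral.
Context {R : realType} {T : topGroupType}.
Context {mu : {measure set (borel T) -> \bar R}}.
Context {K : set T} (KG : group_closed (mem K)) (oK : open K).
Hypothesis mu_lcoset : forall x (A : set (borel T)),
  measurable A -> mu (lcoset (x : T) A) = mu A.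
Hypothesis muK : mu K = 1%E.

(** Cosets are disjoint, so the only summand that can be nonzero is the one for [lcoset t K]. *)
Lemma coset_sumE {V : nmodType} (g : T -> V) (S : set (set T)) t :
  S `<=` lcosets setT K -> (forall t k, K k -> g (t * k)%g = g t) ->
  (forall t, ~ S (lcoset t K) -> g t = 0) ->
  g t = \sum_(A \in S) (if t \in lcoset (coset_repr A) K
                        then g (coset_repr A) else 0).
Proof.
move=> SK gK gS.
have tr A : S A -> t \in lcoset (coset_repr A) K -> A = lcoset t K.
  move=> /SK As /set_mem tA; rewrite (lcoset_repr KG As (coset_reprP KG As)).
  exact: lcoset_eq.
have [St|St] := pselect (S (lcoset t K)); last first.
  rewrite gS// fsbig1// => A SA; case: ifPn => // /(tr _ SA) At.
  by rewrite At in SA.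
have St' := SK _ St.
rewrite -(fsbig_widen [set lcoset t K])/=; first last.
- move=> A [SA /= At]; case: ifPn => // /(tr _ SA) E.
  by case: At; rewrite E.
- by move=> A ->.
rewrite fsbig_set1.
have [k Kk <-] := coset_reprP KG St'.
rewrite gK// ifT//; apply/mem_set/lcosetP; rewrite invgM mulgVK.
exact: subgroupV.
Qed.

(** By [coset_sumE], [g] is a finite combination of indicators of cosets, each of measure 1. *)
Lemma ge0_integral_coset (g : T -> R) (S : set (set T)) :
  finite_set S -> S `<=` lcosets setT K ->
  (forall t, 0 <= g t) -> (forall t k, K k -> g (t * k)%g = g t) ->
  (forall t, ~ S (lcoset t K) -> g t = 0) ->
  (\int[mu]_t (g t)%:E = (\sum_(A \in S) g (coset_repr A))%:E)%E.
Proof.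
move=> finS SK g0 gK gS.
pose F A t := (g (coset_repr A) * \1_(lcoset (coset_repr A) K) t)%:E.
have mA (A : set T) : measurable (lcoset (coset_repr A) K : set (borel T)).
  by apply: measurable_open; exact: open_lcoset.
under eq_integral => t _.
  rewrite (coset_sumE _ _ t SK gK gS) -fsumEFin//.
  under eq_fsbigr => A _.
    have -> : (if t \in lcoset (coset_repr A) K then g (coset_repr A) else 0)%:E
        = F A t :> \bar R.
      by rewrite /F indicE; case: ifP; rewrite ?mulr1 ?mulr0.
    over.
  over.
rewrite (@ge0_integral_fsum _ (borel T) R mu setT _ _ F)//.
- rewrite -fsumEFin//; apply: eq_fsbigr => A _; rewrite /F.
  under eq_integral do rewrite EFinM.
  rewrite ge0_integralZl_EFin//; last first.
    by apply/measurable_EFinP/measurable_indic.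
  by rewrite integral_indic// setIT mu_lcoset ?muK ?mule1//;
    exact: measurable_open.
- by move=> A; apply/measurable_EFinP/measurable_funM.
- by move=> A t _; rewrite lee_fin mulr_ge0// indicE.
Qed.

Lemma Rintegral_coset (g : T -> R) (S : set (set T)) :
  finite_set S -> S `<=` lcosets setT K ->
  (forall t k, K k -> g (t * k)%g = g t) ->
  (forall t, ~ S (lcoset t K) -> g t = 0) ->
  \int[mu]_t g t = \sum_(A \in S) g (coset_repr A).
Proof.
move=> finS SK gK gS; rewrite Rintegral_max.
rewrite !(ge0_integral_coset _ S)//.
- rewrite -EFinB /= !fsbig_finite//= -sumrB; apply: eq_bigr => A _.
  have [g0|g0] := leP 0 (g (coset_repr A)).
    by rewrite max_r ?oppr_le0// subr0.
  by rewrite max_l ?oppr_ge0 ?(ltW g0)// sub0r opprK.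
- by move=> t; rewrite le_max lexx orbT.
- by move=> t k Kk; rewrite gK.
- by move=> t St; rewrite gS// oppr0 maxxx.
- by move=> t; rewrite le_max lexx orbT.
- by move=> t k Kk; rewrite gK.
- by move=> t St; rewrite gS// maxxx.
Qed.

(** The real and imaginary parts are summed over the finite set [S]; the sum then widens to all
    cosets, as [F] vanishes on those outside [S]. This is the shape of the sum in [hecke_conv]. *)
Lemma Cintegral_coset (F : T -> Cplx R) (S : set (set T)) :
  finite_set S -> S `<=` lcosets setT K ->
  (forall t k, K k -> F (t * k)%g = F t) ->
  (forall t, ~ S (lcoset t K) -> F t = 0) ->
  Cintegral mu F = \sum_(A \in lcosets setT K) F (coset_repr A).
Proof.
move=> finS SK FK FS.
rewrite -(fsbig_widen S)//; last first.
  move=> A [As nSA] /=; apply: FS; have := coset_reprP KG As.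
  by move=> /(lcoset_repr KG As) <-.
rewrite /Cintegral !(Rintegral_coset _ S)//.
- by rewrite !fsbig_finite//= complex_sum.
- by move=> t k Kk; rewrite FK.
- by move=> t St; rewrite FS.
- by move=> t k Kk; rewrite FK.
- by move=> t St; rewrite FS.
Qed.

Lemma L1norm_coset (F : T -> Cplx R) (S : set (set T)) :
  finite_set S -> S `<=` lcosets setT K ->
  (forall t k, K k -> F (t * k)%g = F t) ->
  (forall t, ~ S (lcoset t K) -> F t = 0) ->
  L1norm mu F = l1norm K F.
Proof.
move=> finS SK FK FS.
rewrite /L1norm (ge0_integral_coset _ S)//; last 3 first.
- by move=> t; exact: normc_ge0.
- by move=> t k Kk; rewrite FK.
- by move=> t St; rewrite FS// Normc.normc0.
rewrite /l1norm (esumID S)//; last by move=> A _; rewrite lee_fin;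
  exact: normc_ge0.
rewrite [X in (_ + X)%E]esum1 ?adde0; last first.
  move=> A [As SA]; rewrite FS ?Normc.normc0//.
  by rewrite -(lcoset_repr KG As (coset_reprP KG As)).
rewrite ((setIidPr _ _).2 SK) esum_fset//; last by move=> A _;
  rewrite lee_fin; exact: normc_ge0.
by rewrite fsumEFin.
Qed.

End CosetIntegral.

(** * Continuity of the real and imaginary parts *)

Section ComplexContinuity.
Context {R : realType}.

Lemma lipschitz1_continuous (f : Cplx R -> R) :
  (forall z w : Cplx R, (`|f z - f w|%:C)%C <= `|z - w|) -> continuous f.
Proof.
move=> f1 z A /nbhs_ballP[e /= e0 eA]; apply/nbhs_ballP.
exists (e%:C)%C => /= [|w zw]; first by rewrite ltcR.
apply: eA; rewrite /ball /= -ltcR; exact: le_lt_trans (f1 _ _) zw.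
Qed.

Lemma Re_continuous : continuous (@complex.Re R : Cplx R -> R).
Proof.
apply: lipschitz1_continuous => z w.
have -> : complex.Re z - complex.Re w = complex.Re (z - w).
  by case: z w => [a b] [c d].
exact: normc_ge_Re.
Qed.

Lemma Im_continuous : continuous (@complex.Im R : Cplx R -> R).
Proof.
apply: lipschitz1_continuous => -[a b] [c d].
rewrite normc_def lecR /= -sqrtr_sqr ler_wsqrtr// lerDr sqr_ge0//.
Qed.
End ComplexContinuity.

(** * Left invariance of the integral of continuous functions *)

Section LeftInvariantIntegral.
Context {R : realType} {T : topGroupType}.
Context {mu : {measure set (borel T) -> \bar R}}.
Hypothesis mu_lcoset : forall x (A : set (borel T)),
  measurable A -> mu (lcoset (x : T) A) = mu A.

Lemma continuous_measurable_borel (g : T -> R) :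
  continuous g -> measurable_fun (setT : set (borel T)) (g : borel T -> R).
Proof.
move=> /continuousP cg; apply: (measurability _ (RGenOpens.measurableE R)).
move=> _ [_ [a [b ->] <-]]; rewrite setTI; apply: measurable_open.
exact/cg/interval_open.
Qed.

Lemma measurable_mulgl (h : T) :
  measurable_fun (setT : set (borel T)) (fun t : borel T => (h * t)%g : borel
    T).
Proof.
apply: (@measurability _ _ (borel T) (borel T) setT _ (@open T) erefl) => _ [U
  oU <-].
rewrite setTI; apply: measurable_open.
by apply: open_comp oU => t _; exact: mulgl_continuous.
Qed.

(** Left invariance says that [mu] equals its pushforward under translation by [h]; the rest is
    change of variables. *)
Lemma ge0_integral_mulgl (h : T) (g : T -> R) :
  (forall t, 0 <= g t) -> continuous g ->
  (\int[mu]_t (g (h * t)%g)%:E = \int[mu]_t (g t)%:E)%E.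
Proof.
move=> g0 cg.
pose phi (t : borel T) : borel T := (h * t)%g.
have -> : (\int[mu]_t (g t)%:E = \int[pushforward mu phi]_t (g t)%:E)%E.
  apply: eq_measure_integral; first exact: measurable_mulgl.
  move=> mphi A mA _.
  rewrite /pushforward /=.
  rewrite -(mu_lcoset h^-1%g)//; congr (mu _); apply/seteqP; split=> t.
    by move=> /lcosetP; rewrite invgK.
  by move=> ?; apply/lcosetP; rewrite invgK.
rewrite (ge0_integral_pushforward (measurable_mulgl h))//.
  by apply/measurable_EFinP; exact: continuous_measurable_borel.
by move=> t _; rewrite lee_fin.
Qed.

Lemma Rintegral_mulgl (h : T) (g : T -> R) : continuous g ->
  \int[mu]_t g (h * t)%g = \int[mu]_t g t.
Proof.
move=> cg; rewrite !Rintegral_max.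
have cmax (f : T -> R) : continuous f -> continuous (fun t => Num.max (f t) 0).
  by move=> cf t; apply: continuous_max; [exact: cf|exact: cst_continuous].
rewrite (ge0_integral_mulgl h (fun t => Num.max (g t) 0)); first last.
- exact: cmax.
- by move=> t; rewrite le_max lexx orbT.
rewrite (ge0_integral_mulgl h (fun t => Num.max (- g t) 0))//.
- by move=> t; rewrite le_max lexx orbT.
- by apply: (cmax (fun t => - g t)) => t; apply: cvgN; exact: cg.
Qed.

Lemma Cintegral_mulgl (h : T) (F : T -> Cplx R) : continuous F ->
  Cintegral mu (fun t => F (h * t)%g) = Cintegral mu F.
Proof.
move=> cF; rewrite /Cintegral.
rewrite (Rintegral_mulgl h (fun t => complex.Re (F t))); last first.
  by move=> t; apply: continuous_comp; [exact: cF|exact: Re_continuous].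
rewrite (Rintegral_mulgl h (fun t => complex.Im (F t)))//.
by move=> t; apply: continuous_comp; [exact: cF|exact: Im_continuous].
Qed.

End LeftInvariantIntegral.

(** * Intrinsic description of the Hecke algebra *)

Lemma mem_iff {U V : Type} {A : set U} {B : set V} {x y} :
  (A x <-> B y) -> (x \in A) = (y \in B).
Proof. by move=> AB; apply/idP/idP => /set_mem/AB/mem_set. Qed.

Section HeckeElements.
Context {R : realType} {T : topGroupType} {K : set T}.
Hypothesis KG : group_closed (mem K).
Implicit Type f : T -> Cplx R.

Lemma indic_mulr x k : K k -> \1_K (x * k)%g = \1_K x :> Cplx R.
Proof.
by move=> Kk; rewrite !indicE (mem_iff (subgroupMr KG Kk)).
Qed.

Lemma indic_mull x k : K k -> \1_K (k * x)%g = \1_K x :> Cplx R.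
Proof.
by move=> Kk; rewrite !indicE (mem_iff (subgroupMl KG Kk)).
Qed.

(** A bi-invariant function is constant on each double coset. Conversely to its support condition,
    the list [s] is used up by induction, subtracting [f y] times the indicator of [K y K] for its
    head [y]. *)
Lemma hecke_algebraP f : hecke_algebra K f <->
  [/\ forall h x, K h -> f (h * x)%g = f x,
      forall x k, K k -> f (x * k)%g = f x &
      exists s : seq T, forall x, f x != 0 -> exists2 y, y \in s & dcoset K y
        x].
Proof.
have dE y x : \1_(dcoset K y) x = (x \in dcoset K y)%:R :> Cplx R by rewrite
  indicE.
split=> [[s [c ->]]|[fl fr [s fs]]].
  have E x : (\sum_(y <- s) c y *: \1_(dcoset K y)) x =
      \sum_(y <- s) c y * (x \in dcoset K y)%:R.
    by rewrite fct_sumE; apply: eq_bigr => y _; rewrite -dE.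
  split=> [h x Kh|x k Kk|]; rewrite ?E.
  - by apply: eq_bigr => y _; rewrite (mem_iff (dcosetMl KG Kh)).
  - by apply: eq_bigr => y _; rewrite (mem_iff (dcosetMr KG Kk)).
  exists s => x; rewrite E; apply: contra_neqP => sx.
  rewrite big_seq big1// => y ys; rewrite memNset ?mulr0// => yx.
  by apply: sx; exists y.
(* Keeping [s'] inside [s] ensures that a new head [y] outside [s] is not in [s'], so the
   coefficient at [y] can be set without changing the others. *)
suff [s' _ [c ->]] : exists2 s' : seq T, {subset s' <= s} &
    exists c, f = \sum_(x <- s') c x *: \1_(dcoset K x) by exists s', c.
elim: s f fl fr fs => [|y s IHs] f fl fr fs.
  exists [::] => //; exists (fun=> 0); rewrite big_nil; apply/funext => x.
  by apply/eqP/negP => /negP/fs[].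
have [ys|ys] := boolP (y \in s).
  have [x /fs[z]|s' s's fs'] := IHs f fl fr; last first.
    by exists s' => // z /s's zs; rewrite inE zs orbT.
  by rewrite inE => /predU1P[->|zs] zx; [exists y|exists z].
pose f' : T -> Cplx R := f - f y *: \1_(dcoset K y).
have f'E x : f' x = f x - f y * (x \in dcoset K y)%:R by rewrite -dE.
have [| |x|s' s's [c f'c]] := IHs f'.
- by move=> h x Kh; rewrite !f'E fl// (mem_iff (dcosetMl KG Kh)).
- by move=> x k Kk; rewrite !f'E fr// (mem_iff (dcosetMr KG Kk)).
- rewrite f'E; have [[h Kh [k Kk <-]]|xy] := pselect (dcoset K y x).
    rewrite fr// fl// mem_set ?mulr1 ?subrr ?eqxx//.
    by apply/(dcosetM KG) => //; exact: dcoset_self.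
  rewrite memNset// mulr0 subr0 => /fs[z].
  by rewrite inE => /predU1P[->//|zs] zx; exists z.
exists (y :: s') => [z|]; first by rewrite !inE => /predU1P[->|/s's->];
  rewrite ?eqxx ?orbT.
exists (fun x => if x == y then f y else c x); rewrite big_cons eqxx.
rewrite big_seq (eq_bigr (fun x => c x *: \1_(dcoset K x))); last first.
  by move=> z zs'; case: eqVneq => // zy; rewrite -zy s's in ys.
by rewrite -big_seq -f'c /f' addrC subrK.
Qed.

(** Each of the finitely many double cosets carrying [f] is compact, hence a finite union of left
    cosets. This supplies the set [S] for the integral formulas. *)
Lemma hecke_finite_cosets f : open K -> compact K -> hecke_algebra K f ->
  exists S, [/\ finite_set S, S `<=` lcosets setT K &
    forall t, ~ S (lcoset t K) -> f t = 0].
Proof.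
move=> oK cK /hecke_algebraP[_ _ [s fs]].
exists (\bigcup_(y in [set` s]) lcosets (dcoset K y) K); split.
- by apply: bigcup_finite => // y _; exact: finite_lcosets_dcoset.
- by move=> _ [y _ [x _ <-]]; exists x.
- move=> t; apply: contra_notP => /eqP/fs[y ys yt].
  by exists y => //; exists t.
Qed.

End HeckeElements.

(** * The corner of [p] and the elements [p x p] *)

Section Corner.
Context {R : realType} {T : topGroupType}.
Context {mu : {measure set (borel T) -> \bar R}}.
Context {K : set T} (KG : group_closed (mem K)) (oK : open K) (cK : compact K).
Hypothesis mu_lcoset : forall x (A : set (borel T)),
  measurable A -> mu (lcoset (x : T) A) = mu A.
Hypothesis muK : mu K = 1%E.
Implicit Types f g : T -> Cplx R.
Let p : T -> Cplx R := \1_K.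

Let p1 x : K x -> p x = 1.
Proof. by move=> Kx; rewrite /p indicE mem_set. Qed.

Let p0 x : ~ K x -> p x = 0.
Proof. by move=> Kx; rewrite /p indicE memNset. Qed.

Lemma Cintegral_coset1 f x : (forall t k, K k -> f (t * k)%g = f t) ->
  (forall t, ~ lcoset x K t -> f t = 0) -> Cintegral mu f = f x.
Proof.
move=> fK fx; rewrite (Cintegral_coset KG oK mu_lcoset muK _ [set lcoset x
  K])//.
- rewrite -(fsbig_widen [set lcoset x K])/=.
  + rewrite fsbig_set1.
    have [|k Kk <-] := @coset_reprP _ _ KG (lcoset x K) setT; first by exists x.
    exact: fK.
  + by move=> _ ->; exists x.
  + move=> A [As /= Ax]; apply: fx => xA; apply: Ax.
    rewrite (lcoset_repr KG As (coset_reprP KG As)).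
    exact/esym/(lcoset_eq KG).
- by move=> _ ->; exists x.
- move=> t tx; apply: fx => xt; apply: tx; exact/esym/(lcoset_eq KG).
Qed.

(** The integrand [p t * f (t^-1 * x)] is supported on [K] and constant there, with value [f x]. *)
Lemma convol_indicl f :
  (forall h x, K h -> f (h * x)%g = f x) -> convol mu p f = f.
Proof.
move=> fl; apply/funext => x; rewrite /convol (Cintegral_coset1 _ 1%g).
- by rewrite p1 ?mul1r ?invg1 ?mul1g//; exact: subgroup1.
- move=> t k Kk; rewrite /p (indic_mulr KG)// invgM -mulgA fl//.
  exact: subgroupV.
- by move=> t /lcosetP; rewrite invg1 mul1g => Kt; rewrite p0// mul0r.
Qed.

Lemma convol_indicr f :
  (forall x k, K k -> f (x * k)%g = f x) -> convol mu f p = f.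
Proof.
move=> fr; apply/funext => x; rewrite /convol (Cintegral_coset1 _ x).
- by rewrite p1 ?mulr1// mulVg; exact: subgroup1.
- move=> t k Kk; rewrite fr// invgM -mulgA /p (indic_mull KG)//.
  exact: subgroupV.
- move=> t /lcosetP Kt; rewrite p0 ?mulr0// => /(subgroupV KG).
  by rewrite invgM invgK.
Qed.

(** The preimage of any set whatsoever is left [K]-invariant, hence open. *)
Lemma mull_closed_continuous f :
  (forall h x, K h -> f (h * x)%g = f x) -> continuous f.
Proof.
move=> fl; apply/continuousP => A _; apply: (open_mull_closed KG oK).
by move=> x k /= fx Kk; rewrite fl.
Qed.

Lemma mulr_closed_continuous f :
  (forall x k, K k -> f (x * k)%g = f x) -> continuous f.
Proof.
move=> fr; apply/continuousP => A _; apply: (open_mulr_closed KG oK).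
by move=> x k /= fx Kk; rewrite fr.
Qed.

Lemma indicVM_continuous x : continuous (fun t : T => p (t^-1 * x)%g).
Proof.
apply: mulr_closed_continuous => t k Kk.
by rewrite invgM -mulgA /p (indic_mull KG)//; exact: subgroupV.
Qed.

(** Substitute [h * t] for [t]: [p] absorbs [h], and [h] cancels inside the argument of [f]. The
    integrand is continuous because [p] is locally constant. *)
Lemma convol_indicl_mull f h x : continuous f -> K h ->
  convol mu p f (h * x)%g = convol mu p f x.
Proof.
move=> cf Kh; pose F t := p t * f (t^-1 * (h * x))%g.
rewrite /convol -/F -(Cintegral_mulgl mu_lcoset h F).
  congr (Cintegral mu _); apply/funext => t.
  by rewrite /F /p (indic_mull KG)// invgM -mulgA mulKg.
move=> t; apply: (@cvgM _ T).
  apply: mulr_closed_continuous => ? ? ?; exact: indic_mulr.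
apply: continuous_comp; last exact: cf.
by apply: cvgMg; [exact: invg_continuous|exact: cvg_cst].
Qed.

Lemma convol_indicr_mull f h x : (forall h x, K h -> f (h * x)%g = f x) ->
  K h -> convol mu f p (h * x)%g = convol mu f p x.
Proof.
move=> fl Kh; pose F t := f t * p (t^-1 * (h * x))%g.
rewrite /convol -/F -(Cintegral_mulgl mu_lcoset h F).
  congr (Cintegral mu _); apply/funext => t.
  by rewrite /F fl// invgM -mulgA mulKg.
move=> t; apply: (@cvgM _ T); first exact: mull_closed_continuous.
exact: indicVM_continuous.
Qed.

Lemma convol_indicr_mulr f x k : K k -> convol mu f p (x * k)%g = convol mu f p
  x.
Proof.
move=> Kk; congr (Cintegral mu _); apply/funext => t.
by rewrite mulgA /p (indic_mulr KG).
Qed.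

Lemma Cintegral0 : Cintegral mu (fun=> 0 : Cplx R) = 0.
Proof. by rewrite /Cintegral /Rintegral /= !integral0. Qed.

Lemma compact_dcoset_cover (A : set T) : compact A ->
  exists s : seq T, forall x, A x -> exists2 y, y \in s & dcoset K y x.
Proof.
rewrite compact_cover => /(_ T setT (dcoset K))[y _|x Ax|D _ AD].
- by apply: (open_mulr_closed KG oK) => x k xy Kk; exact/(dcosetMr KG).
- by exists x => //; exact: dcoset_self.
- by exists (enum_fset D) => x /AD[y Dy yx]; exists y.
Qed.

(** Both inclusions go through [hecke_algebraP]. Convolving with [p] on both sides makes [f]
    bi-invariant and keeps its support in the double cosets that cover the original support. *)
Lemma corner_hecke : corner mu p = hecke_algebra K.
Proof.
apply/seteqP; split=> [_ [f [cf suppf] <-]|f].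
  apply/(hecke_algebraP KG).
  have fl h x : K h -> convol mu p f (h * x)%g = convol mu p f x.
    by move=> Kh; exact: convol_indicl_mull.
  split=> [h x Kh|x k Kk|]; [exact: convol_indicr_mull|exact:
    convol_indicr_mulr|].
  have [s fs] := compact_dcoset_cover _ suppf.
  have fs0 x : ~ (exists2 y, y \in s & dcoset K y x) -> f x = 0.
    move=> sx; apply/eqP; apply: contra_notT sx => fx.
    by apply/fs/subset_closure.
  exists s => x; apply: contra_neqP => sx.
  rewrite -[RHS]Cintegral0; congr (Cintegral mu _); apply/funext => t.
  (* A nonzero contribution needs [t^-1 * x] and [u] in [K] and [u^-1 * t] in some [K y K], which
     would put [x] in [K y K]. *)
  have [Kt|Kt] := pselect (K (t^-1 * x)%g); last by rewrite p0// mulr0.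
  rewrite [X in X * _](_ : _ = 0) ?mul0r//.
  rewrite -[RHS]Cintegral0; congr (Cintegral mu _); apply/funext => u.
  have [Ku|Ku] := pselect (K u); last by rewrite p0// mul0r.
  rewrite fs0 ?mulr0// => -[y ys yt]; apply: sx; exists y => //.
  rewrite -(mulVKg t x); apply/(dcosetMr KG Kt).
  exact/(dcosetMl KG (subgroupV KG Ku)).
(* Conversely [f] is its own preimage, as [p * f * p = f]; its support lies in [D], a finite union
   of compact double cosets, closed by right invariance. *)
move=> Hf; have /(hecke_algebraP KG)[fl fr [s fs]] := Hf.
exists f; last by rewrite convol_indicl// convol_indicr.
split; first exact: mull_closed_continuous.
pose D := \bigcup_(y in [set` s]) dcoset K y.
have clD : closed D.
  apply: (closed_mulr_closed KG oK) => x k [y ys yx] Kk.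
  by exists y => //; exact/(dcosetMr KG Kk).
apply: (@subclosed_compact _ _ D).
- exact: closed_closure.
- by rewrite /D bigcup_seq; apply: bigsetU_compact => *; exact: compact_dcoset.
- rewrite [X in _ `<=` X](closure_id _).1//;
  apply: closure_subset => x /fs[y ys yx].
  by exists y.
Qed.

Lemma convol_hecke f g : hecke_algebra K f -> hecke_algebra K g ->
  convol mu f g = hecke_conv K f g.
Proof.
move=> Hf /(hecke_algebraP KG)[gl _ _]; apply/funext => x.
have /(hecke_algebraP KG)[_ fr _] := Hf.
have [S [finS SK fS]] := hecke_finite_cosets KG _ oK cK Hf.
rewrite /convol (Cintegral_coset KG oK mu_lcoset muK _ S)//.
- by move=> t k Kk; rewrite fr// invgM -mulgA gl//; exact: subgroupV.
- by move=> t St; rewrite fS// mul0r.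
Qed.

Lemma L1norm_hecke f : hecke_algebra K f -> L1norm mu f = l1norm K f.
Proof.
move=> Hf; have /(hecke_algebraP KG)[_ fr _] := Hf.
have [S [finS SK fS]] := hecke_finite_cosets KG _ oK cK Hf.
exact: (L1norm_coset KG oK mu_lcoset muK _ S).
Qed.

Lemma Cintegral_indic (A : set T) (r : R) : measurable (A : set (borel T)) ->
  mu A = r%:E -> Cintegral mu (\1_A : T -> Cplx R) = (r%:C)%C.
Proof.
move=> mA muA; rewrite /Cintegral.
have reE t : complex.Re (\1_A t : Cplx R) = \1_A t.
  by rewrite !indicE; case: (t \in A).
have imE t : complex.Im (\1_A t : Cplx R) = 0.
  by rewrite !indicE; case: (t \in A).
rewrite (_ : (fun t => complex.Re (\1_A t : Cplx R)) = \1_A :> (T -> R));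
  last first.
  exact/funext.
rewrite (_ : (fun t => complex.Im (\1_A t : Cplx R)) = cst 0);
  last exact/funext.
rewrite /Rintegral integral0 [X in fine X](_ : _ = r%:E)//.
by rewrite -muA -(setIT A) -integral_indic// setIT.
Qed.

Lemma natr_complexV n : (n%:R^-1%:C)%C = n%:R^-1 :> Cplx R.
Proof. by rewrite fmorphV rmorph_nat. Qed.

(** At [y = h x k] the integrand is the indicator of the coset of [h] modulo the stabiliser of [x K]
    in [K], which has measure [1 / L(x)]. Off [K x K] the integrand vanishes. *)
Lemma compress_dcoset x :
  compress mu p x = (hecke_L K x)%:R^-1 *: (\1_(dcoset K x) : T -> Cplx R).
Proof.
apply/funext => y; rewrite [RHS]/(_ *: _) /= indicE /compress /convol /lact.
have [[h Kh [k Kk yE]]|xy] := pselect (dcoset K x y); last first.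
  rewrite memNset// mulr0 -[RHS]Cintegral0; congr (Cintegral mu _).
  apply/funext => t.
  have [Kt|Kt] := pselect (K t); last by rewrite p0// mul0r.
  rewrite [X in _ * X]p0 ?mulr0// => Kty; apply: xy.
  exists t => //; exists (x^-1 * (t^-1 * y))%g => //.
  by rewrite !mulgA mulgK mulgV mul1g.
have xy : dcoset K x y by exists h => //; exists k.
rewrite mem_set// mulr1 -natr_complexV -(Cintegral_indic (lcoset h (K `&`
  conjg_set x K))).
- congr (Cintegral mu _); apply/funext => t.
  have [Kt|Kt] := pselect (K t); last first.
    rewrite p0// mul0r indicE memNset// => /lcosetP[Kht _]; apply: Kt.
    by rewrite -(mulVKg h t); exact: subgroupM.
  rewrite p1// mul1r /p !indicE; congr (_%:R); congr nat_of_bool;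
    apply: mem_iff.
  rewrite (stab_lcosetP KG Kh Kt).
  split=> [|/lcosetP/(subgroupV KG)].
    rewrite -yE !mulgA => /(subgroupMr KG Kk) Kz.
    by apply/lcosetP/(subgroupVE KG); rewrite !invgM !invgK !mulgA.
  by rewrite -yE !invgM !invgK !mulgA => Kz; exact/(subgroupMr KG Kk).
- by apply: measurable_open; apply: open_lcoset; exact: open_stab.
- exact: mu_stab_lcoset.
Qed.

(** The summand for [A] is the indicator of [r A * x * K]. By [stab_lcosetP] these cosets partition
    [K x K], whichever representatives [r] picks. *)
Lemma sum_lact_dcoset x (r : set T -> T) :
  (forall A, lcosets K (K `&` conjg_set x K) A -> A (r A)) ->
  \sum_(A \in lcosets K (K `&` conjg_set x K)) lact (r A) (lact x p) =
  (\1_(dcoset K x) : T -> Cplx R).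
Proof.
move=> rP; set Kx := K `&` conjg_set x K.
have sG := group_closedI_conjg KG x.
have finKx := finite_lcosets_stab KG oK cK x.
have Kr A : lcosets K Kx A -> K (r A).
  move=> As; have := rP _ As; case: As => h Kh <- [z [Kz _] <-];
    exact: subgroupM.
apply/funext => y; rewrite fsbig_finite// fct_sumE -fsbig_finite//.
have [xy|xy] := pselect (dcoset K x y); last first.
  rewrite indicE memNset// fsbig1// => A As; rewrite /lact p0// => Ky;
    apply: xy.
  exists (r A); first exact: Kr.
  by exists (x^-1 * ((r A)^-1 * y))%g; rewrite // !mulgA mulgK mulgV mul1g.
rewrite indicE mem_set//; case: xy => h Kh [k Kk <-].
have hs : lcosets K Kx (lcoset h Kx) by exists h.
rewrite -(fsbig_widen [set lcoset h Kx])/=; first last.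
- move=> A [As /= Ah]; rewrite /lact p0// => Kz; apply: Ah.
  rewrite (lcoset_repr sG As (rP _ As)); apply/(lcoset_eq sG).
  apply/(stab_lcosetP KG (Kr _ As) Kh)/lcosetP.
  by move: Kz; rewrite invgM !mulgA => /(subgroupMr KG Kk).
- by move=> _ ->.
rewrite fsbig_set1 /lact p1//; have /(stab_lcosetP KG Kh (Kr _ hs)) := rP _ hs.
move=> /lcosetP/(subgroupV KG); rewrite !invgM !invgK !mulgA => Kz.
exact/(subgroupMr KG Kk).
Qed.

(** The value [1 / L(x)] is taken on [K x K], whose measure is [L(x)]. *)
Lemma L1norm_compress x : L1norm mu (compress mu p x) = 1%E.
Proof.
rewrite compress_dcoset /L1norm.
have mD : measurable (dcoset K x : set (borel T)).
  apply: measurable_open; apply: (open_mulr_closed KG oK) => y k xy Kk.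
  exact/(dcosetMr KG).
have E t : Normc.normc (((hecke_L K x)%:R^-1 *: (\1_(dcoset K x) : T -> Cplx
  R)) t) =
    (hecke_L K x)%:R^-1 * \1_(dcoset K x) t :> R.
  rewrite [X in Normc.normc X]/(_ *: _) /= !indicE -natr_complexV.
  case: (t \in _); last by rewrite !mulr0 Normc.normc0.
  by rewrite !mulr1 /= expr0n addr0 sqrtr_sqr ger0_norm.
transitivity (\int[mu]_t ((hecke_L K x)%:R^-1%:E * (\1_(dcoset K x) t)%:E))%E.
  by apply: eq_integral => t _; rewrite E EFinM.
rewrite ge0_integralZl_EFin//; last first.
  by apply/measurable_EFinP; exact: measurable_indic.
rewrite integral_indic// setIT (mu_dcoset KG oK cK mu_lcoset muK) -EFinM
  mulVf//.
by rewrite pnatr_eq0 -lt0n (hecke_L_gt0 KG oK cK).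
Qed.

End Corner.

(** * Compactness of an open subgroup of Haar measure 1 *)

Section CompactSubgroup.
Context {R : realType} {T : topGroupType}.
Context {mu : {measure set (borel T) -> \bar R}}.
Context {K : set T} (KG : group_closed (mem K)) (oK : open K).
Hypothesis mu_haar : left_haar mu.
Hypothesis muK : mu K = 1%E.

(* Inner regularity gives a compact [C] inside [K] with [mu C > 1/2]. For [h] in
   [K] the translate [h C] must then meet [C], so that [K = C C^-1]. *)
Lemma compact_open_subgroup : hausdorff_space T -> compact K.
Proof.
move=> hT; case: mu_haar => -[_ _ inner] _ mu_lcoset.
have fin1 : ereal_sup [set mu C | C in [set C : set T | compact C /\ C `<=` K]]
    \is a fin_num by rewrite -(inner _ oK) muK.
have [|_ [C [cC CK] <-]] := @ub_ereal_sup_adherent R _ 2^-1 _ fin1.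
  by rewrite invr_gt0.
rewrite -(inner _ oK) muK => muC.
(* In a Hausdorff space compact sets are closed, hence Borel. *)
have mcompact D : compact D -> measurable (D : set (borel T)).
  move=> cD; rewrite -[X in measurable X]setCK; apply: measurableC.
  by apply: measurable_open; apply: closed_openC; exact: compact_closed.
have mC := mcompact _ cC.
have KE : K = [set (ab.1 * ab.2^-1)%g | ab in C `*` C].
  apply/seteqP; split=> [h Kh|_ [[a b] [/CK Ka /CK Kb] <-]]; last first.
    by apply: (subgroupM KG) => //; exact: subgroupV.
  have [[c [/lcosetP hc Cc]]|hC] := pselect (exists c, lcoset h C c /\ C c).
    by exists (c, h^-1 * c)%g => //=; rewrite invgM invgK mulVKg.
  have mhC : measurable (lcoset h C : set (borel T)).
    apply: mcompact; apply: continuous_compact cC.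
    by apply: continuous_subspaceT; exact: mulgl_continuous.
  have : (mu (lcoset h C `|` C) <= 1)%E.
    rewrite -muK; apply: le_measure; [exact/mem_set/measurableU| |].
      by apply/mem_set; exact: measurable_open.
    move=> t [[c /CK Kc <-]|/CK//]; exact: subgroupM.
  rewrite measureU//; last first.
    by apply/seteqP; split=> // c [hc Cc]; apply: hC; exists c.
  rewrite [X in (X + _)%E](mu_lcoset h C mC) leNgt => /negP[].
  apply: le_lt_trans (lteD muC muC); rewrite -EFinB -EFinD lee_fin; lra.
rewrite KE; apply: continuous_compact (compact_setX cC cC).
apply: continuous_subspaceT => -[a b].
apply: cvgMg; first exact: cvg_fst.
by apply: continuous_comp; [exact: cvg_snd|exact: invg_continuous].
Qed.

End CompactSubgroup.

(** * The subgroup [Hbar] of the Schlichting completion *)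

Section SchlichtingSubgroup.
Context {G : groupType} {H : set G} (HH : hecke_pair H).
Local Notation Gbar := (schlichting HH).
Implicit Types f g : Gbar.

(** Evaluation at [coset1 H] is locally constant, so limits of elements of [theta H h] with [h] in
    [H] fix that coset. Conversely, if [f] fixes it, so does every [theta H x] close enough to [f],
    which forces [x] into [H]. *)
Lemma HbarP f : Hbar HH f <-> val f (coset1 H) = coset1 H.
Proof.
split=> [|f1 B Bf].
  move=> /(_ _ (nbhs_coset_map (val f) (coset1 H)))[_ [[h Hh <-] /= <-]].
  apply: val_inj; rewrite /= lcosetM mulg1; apply/esym/(lcoset_eq HH.1).
  by apply/lcosetP; rewrite invg1 mul1g.
have fG : Gbar_set H (val f) := set_valP f.
have [_ [[x _ <-] [Bx /= x1]]] := fG _ (filterI Bf (nbhs_coset_map (val f)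
  (coset1 H))).
exists (theta H x); split=> //; exists x => //.
by apply: (theta_coset1 HH); rewrite x1.
Qed.

Lemma open_sch_eq f A : open [set g : Gbar | val g A = val f A].
Proof.
rewrite openE => g /= gA; have := sch_nbhs g A; apply: filterS => k /= ->.
exact: gA.
Qed.

Lemma open_Hbar : open (Hbar HH).
Proof.
rewrite (_ : Hbar HH = [set g : Gbar | val g (coset1 H) = val (1%g : Gbar)
  (coset1 H)]).
  exact: open_sch_eq.
by apply/seteqP; split=> f /HbarP.
Qed.

Lemma group_closed_Hbar : group_closed (mem (Hbar HH)).
Proof.
split; first by apply/mem_set/HbarP.
move=> f g /set_mem/HbarP f1 /set_mem/HbarP g1; apply/mem_set/HbarP.
rewrite -[LHS]/(val f (val g^-1%g (coset1 H))) -{1}g1.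
by rewrite -[X in val f X]/(ginv (val g) (val g (coset1 H))) ginvK//;
  exact: set_valP.
Qed.

(** Distinct maps differ at some coset [A], and prescribing the value at [A] defines an open set. *)
Lemma schlichting_hausdorff : hausdorff_space Gbar.
Proof.
rewrite open_hausdorff => f g /eqP fg.
have [A fgA] : exists A, val f A <> val g A.
  apply/existsNP => fgA; apply: fg; apply: val_inj; exact/funext.
exists ([set k : Gbar | val k A = val f A], [set k : Gbar | val k A = val g A]).
  by split; apply/mem_set.
split; [exact: open_sch_eq|exact: open_sch_eq|].
apply/eqP/seteqP; split=> // k [/= kf kg]; apply: fgA.
exact: etrans (esym kf) kg.
Qed.

End SchlichtingSubgroup.

Theorem corollary4p4 (R : realType) (G : groupType) (H : set G)
  (HH : hecke_pair H) (Hred : reduced H)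
  (mu : {measure set (borel (schlichting HH)) -> \bar R})
  (mu_haar : left_haar mu) (mu_Hbar : mu (Hbar HH) = 1%E)
  (Delta : schlichting HH -> R) (Delta_mod : modular_function mu Delta) :
  let Hb : set (schlichting HH) := Hbar HH in
  let p : schlichting HH -> Cplx R := \1_Hb in
  [/\ forall x : schlichting HH,
        let Hx := Hb `&` conjg_set x Hb in
        let L := hecke_L Hb x in
        [/\ L = subgroup_index Hb Hx,
            (forall r : set (schlichting HH) -> schlichting HH,
              (forall A, lcosets Hb Hx A -> A (r A)) ->
              compress mu p x =
                (L%:R)^-1 *: \sum_(A \in lcosets Hb Hx) lact (r A) (lact x p))
          & compress mu p x = (L%:R)^-1 *: \1_(dcoset Hb x)],
      [/\ corner mu p = hecke_algebra Hb,
          (forall f g, corner mu p f -> corner mu p g ->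
            convol mu f g = hecke_conv Hb f g)
        & (forall f, corner mu p f -> star Delta f = hecke_star Hb f)],
      (forall f, corner mu p f -> L1norm mu f = l1norm Hb f)
    & (forall x : schlichting HH, L1norm mu (compress mu p x) = 1%E)].
Proof.
move=> Hb p.
have KG : group_closed (mem Hb) := group_closed_Hbar HH.
have oK : open Hb := open_Hbar HH.
have cK : compact Hb.
  exact: compact_open_subgroup KG oK mu_haar mu_Hbar (schlichting_hausdorff HH).
have mu_lcoset := (let: And3 _ _ h := mu_haar in h).
have CE : corner mu p = hecke_algebra Hb.
  exact: corner_hecke KG oK cK mu_lcoset mu_Hbar.
split.
- move=> x; split; first exact: hecke_L_index.
  + move=> r rP; rewrite (sum_lact_dcoset KG oK cK)//.
    exact: (compress_dcoset KG oK cK mu_lcoset mu_Hbar).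
  + exact: (compress_dcoset KG oK cK mu_lcoset mu_Hbar).
- split=> // [f g|f _]; first by rewrite CE; exact: convol_hecke.
  (* The two involutions differ only in their modular factor, and [Delta] is the Hecke modular
     function of [Hb]. *)
  apply/funext => x; rewrite /star /hecke_star.
  by rewrite (modular_hecke_Delta KG oK cK mu_lcoset mu_Hbar _ Delta_mod.2).
- by move=> f; rewrite CE; exact: L1norm_hecke.
- exact: (L1norm_compress KG oK cK mu_lcoset mu_Hbar).
Qed.
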